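(* For any constants $\delta>0$ and $c\in(0,1)$, there is no algorithm that evaluates $\hat f$ on only a polynomial number of sets and achieves approximation ratio $(1+\frac{c}{1-c}e^{-1}-\delta)$ for the problem $\min\{\hat f(S):|S|\le r\}$, where $\hat f:2^X\to\mathbb{R}_{\ge0}$ ranges over monotone nonincreasing supermodular functions with total curvature at most $c$ (given by a value oracle).
   Context: For $A\subseteq X$, $j\notin A$, $\hat f_A(j)=\hat f(A\cup\{j\})-\hat f(A)$. $\hat f$ is supermodular if $\hat f_A(j)\le\hat f_B(j)$ for $A\subseteq B$, $j\notin B$. Total curvature: $1-\min_{j\in X}\hat f_{X\setminus\{j\}}(j)/\hat f_\emptyset(j)$. An $\alpha$-approximation for minimization returns a feasible $S$ with $\hat f(S)\le\alpha\cdot\min_{|T|\le r}\hat f(T)$. *)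

(* Defs.v *)
From HB Require Import structures.
From mathcomp Require Import all_boot all_order all_algebra.
From mathcomp Require Import reals sequences exp.

Set Implicit Arguments.
Unset Strict Implicit.
Unset Printing Implicit Defensive.

Import Order.TTheory GRing.Theory Num.Theory.
Local Open Scope ring_scope.

Section SetFunctions.
Variables (R : realType) (X : finType).
Implicit Types (f : {set X} -> R) (A B : {set X}) (j : X).

Definition marginal f A j : R := f (j |: A) - f A.

Definition nonincreasing_setfun f : Prop :=
  forall A B, A \subset B -> f B <= f A.

Definition supermodular f : Prop :=
  forall A B j, A \subset B -> j \notin B -> marginal f A j <= marginal f B j.

(* Elements with marginal f set0 j = 0, where the ratio is 0/0, are left out of
   the minimum, as is usual for the curvature; for a nonincreasing supermodular
   f all the marginals of such an element vanish.  For such f every remaining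
   ratio lies in [0, 1], so the default value 1 only matters when there is no
   remaining element (the curvature is then 0). *)
Definition curvature f : R :=
  1 - \big[Num.min/1]_(j : X | marginal f set0 j != 0)
        (marginal f (setT :\ j) j / marginal f set0 j).

Definition feasible_input (c : R) f : Prop :=
  [/\ forall A, 0 <= f A, nonincreasing_setfun f, supermodular f
    & curvature f <= c].

(* The default value f set0 is harmless since set0 is always feasible. *)
Definition opt f (r : nat) : R :=
  \big[Num.min/f set0]_(T : {set X} | (#|T| <= r)%N) f T.

End SetFunctions.

(* A value-oracle algorithm on the ground set X is an adaptive decision tree:
   it either stops with an output, or asks for the value of the function on a
   set A and continues depending on the answer.  The continuations are arbitrary
   functions: the computation between two evaluations is not limited. *)
Inductive oracle_alg (R : Type) (X : finType) : Type :=
| Output of {set X}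
| Query of {set X} & (R -> oracle_alg R X).

Fixpoint output (R : Type) (X : finType) (f : {set X} -> R)
    (a : oracle_alg R X) : {set X} :=
  match a with
  | Output T => T
  | Query A k => output f (k (f A))
  end.

Fixpoint evaluated (R : Type) (X : finType) (f : {set X} -> R)
    (a : oracle_alg R X) : {set {set X}} :=
  match a with
  | Output _ => set0
  | Query A k => A |: evaluated f (k (f A))
  end.

(* An algorithm for the problem, given the size n of the ground set
   X = {0, ..., n-1} and the cardinality bound r. *)
Definition algorithm (R : Type) : Type :=
  forall n : nat, nat -> oracle_alg R 'I_n.

Definition polynomial_evaluations (R : realType) (c : R) (alg : algorithm R)
    : Prop :=
  exists p : {poly nat}, forall (n r : nat) (f : {set 'I_n} -> R),
    feasible_input c f -> (#|evaluated f (alg n r)| <= p.[n])%N.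

Definition achieves_ratio (R : realType) (c alpha : R) (alg : algorithm R)
    : Prop :=
  forall (n r : nat) (f : {set 'I_n} -> R), feasible_input c f ->
    (#|output f (alg n r)| <= r)%N /\
    f (output f (alg n r)) <= alpha * opt f r.

(* Main.v *)
(**
A uniformly random set O of size m is hidden in a ground set of size n = K m.
Write A for the complement of the selected set S, so that |S| <= n - m means
|A| >= m.  The cost of S is h(A) = |A| - c g(A), where g is monotone, submodular
and has all its marginals in [0, 1]; this makes the total curvature at most c.
The function g credits O with almost m, so the optimum is about (1 - c) m, but
as long as |A inter O| is small, or |A| is large enough to saturate g, g(A)
depends only on |A| and is about (1 - 1/e) m when |A| = m.  For a fixed A that
does not saturate g, the probability that |A inter O| is not small is
exponentially small in m, so some O fools every set evaluated, as well as the
output, in the run of the algorithm on the instance in which nothing is hidden.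
The ratio is then about (1 - c + c/e) / (1 - c) = 1 + c/(1 - c) * 1/e.
*)
Require Import Defs.
From HB Require Import structures.
From mathcomp Require Import all_boot all_order all_algebra.
From mathcomp Require Import reals sequences exp.
From mathcomp Require Import zify ring lra.

Set Implicit Arguments.
Unset Strict Implicit.
Unset Printing Implicit Defensive.

Import Order.TTheory GRing.Theory Num.Theory.
Local Open Scope ring_scope.

(** * Oracle runs, and exponential against polynomial growth *)

Lemma output_eq (R : Type) (X : finType) (f g : {set X} -> R)
    (a : oracle_alg R X) :
  {in evaluated f a, g =1 f} -> output g a = output f a.
Proof.
elim: a => [//|A k IHk] /= eq_fg.
rewrite eq_fg ?setU11 //; apply: IHk => B fB.
by apply: eq_fg; rewrite inE fB orbT.
Qed.

Lemma horner_nat_le (p : {poly nat}) (x : nat) : (0 < x)%N ->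
  (p.[x] <= (\sum_(i < size p) nth 0%N p i)%N * x ^ size p)%N.
Proof.
move=> x0; rewrite horner_coef big_distrl /=; apply: leq_sum => i _.
by rewrite natrXE; apply: leq_mul => //; rewrite leq_pexp2l // ltnW.
Qed.

Lemma poly_lt_exp2 (p : {poly nat}) (C : nat) : (0 < C)%N ->
  exists2 t, (0 < t)%N & (p.[(C * t)%N] + 1 < 2 ^ t)%N.
Proof.
move=> C0; set D := (\sum_(i < size p) nth 0%N p i)%N; set d := size p.
(* The polynomial will be bounded by 2 to the power [D + 1 + (C + s) * d]. As [s * d = u * (2 * d)],
   this exponent is at most [u + u * u], which is below [u.+1 * u.+1 <= 2 ^ s]. *)
pose u := (D + 1 + C * d + 2 * d)%N; pose s := (u + u)%N.
exists (2 ^ s)%N; first by rewrite expn_gt0.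
have x0 : (0 < C * 2 ^ s)%N by rewrite muln_gt0 C0 expn_gt0.
have xd0 : (0 < (C * 2 ^ s) ^ d)%N by rewrite expn_gt0 x0.
have le1 : (p.[(C * 2 ^ s)%N] + 1 <= (D + 1) * (C * 2 ^ s) ^ d)%N.
  by rewrite mulnDl mul1n leq_add // horner_nat_le.
have le2 : ((D + 1) * (C * 2 ^ s) ^ d <= 2 ^ (D + 1) * (2 ^ C * 2 ^ s) ^ d)%N.
  rewrite leq_mul ?(ltnW (ltn_expl _ _)) //.
  by case: (d) => // e; rewrite leq_exp2r // leq_mul2r ltnW ?orbT // ltn_expl.
apply: leq_ltn_trans (leq_trans le1 le2) _.
rewrite -expnD -expnM -expnD ltn_exp2l //.
have u2 : (u < 2 ^ u)%N by exact: ltn_expl.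
have : (u.+1 * u.+1 <= 2 ^ s)%N by rewrite /s expnD leq_mul.
apply: leq_trans; rewrite /s; have : (2 * d <= u)%N by rewrite /u; lia.
have : (D + 1 + C * d <= u)%N by rewrite /u; lia.
move: u {u2 s x0 xd0 le1 le2} => u; nia.
Qed.

(** * Counting the sets of size [m] that meet a given set in many elements *)

(** The quotient of the two binomials is the product of the [t] factors [(m - i) / (n - i)], each at
    most [1 / K]. *)
Lemma bin_subset_density (K t m n : nat) :
  (0 < K)%N -> (t <= m)%N -> (K * m <= n)%N ->
  (K ^ t * 'C(n - t, m - t) <= 'C(n, m))%N.
Proof.
move=> K0; elim: t m n => [|t IHt] [|m] [|n] //=; rewrite ?mul1n ?subn0 //.
- by rewrite leqn0 muln_eq0 eqn0Ngt K0.
- rewrite !subSS ltnS expnSr -mulnA => tm Kmn.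
  have step : (K * 'C(n, m) <= 'C(n.+1, m.+1))%N.
    rewrite -(leq_pmul2l (ltn0Sn m)) -mul_bin_diag mulnA [(m.+1 * K)%N]mulnC.
    by rewrite leq_mul.
  apply: leq_trans step; rewrite mulnCA leq_mul2l; apply/orP; right.
  by apply: IHt => //; nia.
Qed.

Lemma card_supersets (X : finType) (D : {set X}) (m : nat) :
  (#|[set O : {set X} | (#|O| == m) && (D \subset O)]|
     <= 'C(#|X| - #|D|, m - #|D|))%N.
Proof.
have -> : (#|X| - #|D|)%N = #|~: D| by rewrite [RHS]cardsCs setCK.
set S := [set O | _].
have injS : {in S &, injective (fun O => O :\: D)}.
  move=> O P; rewrite !inE => /andP[_ DO] /andP[_ DP] eqD.
  by rewrite -(setID O D) -(setID P D) eqD (setIidPr DO) (setIidPr DP).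
rewrite -cards_draws -(card_in_imset injS).
apply/subset_leq_card/subsetP => _ /imsetP[O + ->].
rewrite !inE => /andP[/eqP <- DO].
by rewrite setDE subsetIr -setDE cardsD (setIidPr DO) eqxx.
Qed.

Lemma card_bigcup_le (I X : finType) (P : {set I}) (F : I -> {set X}) :
  (#|\bigcup_(i in P) F i| <= \sum_(i in P) #|F i|)%N.
Proof.
elim/big_rec2: _ => [|i s A _ leA]; first by rewrite cards0.
by rewrite (leq_trans (leq_card_setU _ _).1) // leq_add2l.
Qed.

(** Union bound over the subsets [D] of [A] of size [t]: there are at most [2 ^ #|A|] of them, and
    each lies in at most a fraction [1 / K ^ t] of the sets of size [m]. *)
Lemma card_large_intersection (X : finType) (A : {set X}) (K t m : nat) :
  (0 < K)%N -> (t <= m)%N -> (K * m <= #|X|)%N ->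
  (K ^ t * #|[set O : {set X} | (#|O| == m) && (t <= #|A :&: O|)%N]|
     <= 2 ^ #|A| * 'C(#|X|, m))%N.
Proof.
move=> K0 tm Km.
pose Ds := [set D : {set X} | D \subset A & #|D| == t].
have sub : [set O : {set X} | (#|O| == m) && (t <= #|A :&: O|)%N] \subset
    \bigcup_(D in Ds) [set O : {set X} | (#|O| == m) && (D \subset O)].
  apply/subsetP => O; rewrite inE => /andP[Om tAO].
  have : (0 < #|[set D : {set X} | D \subset A :&: O & #|D| == t]|)%N.
    by rewrite cards_draws bin_gt0.
  case/card_gt0P => D; rewrite inE subsetI -andbA => /and3P[DA DO Dt].
  by apply/bigcupP; exists D; rewrite !inE ?DA ?Dt ?Om.
have leDs : (#|Ds| <= 2 ^ #|A|)%N.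
  rewrite -card_powerset subset_leq_card //; apply/subsetP => D.
  by rewrite !inE => /andP[].
have := leq_trans (subset_leq_card sub) (card_bigcup_le _ _).
rewrite -(leq_pmul2l (_ : 0 < K ^ t)%N) ?expn_gt0 ?K0 // big_distrr /= => le1.
apply: leq_trans le1 _.
apply: (@leq_trans (\sum_(D in Ds) 'C(#|X|, m))).
  apply: leq_sum => D; rewrite inE => /andP[_ /eqP Dt].
  apply: leq_trans (bin_subset_density K0 tm Km).
  by rewrite leq_mul // -Dt card_supersets.
by rewrite sum_nat_const leq_mul.
Qed.

Lemma exists_small_intersection (X : finType) (Q : {set {set X}})
    (K t m L : nat) :
  (0 < K)%N -> (t <= m)%N -> (K * m <= #|X|)%N ->
  (forall A, A \in Q -> (#|A| <= L)%N) -> (#|Q| * 2 ^ L < K ^ t)%N ->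
  exists2 O : {set X}, #|O| = m &
    forall A, A \in Q -> (#|A :&: O| < t)%N.
Proof.
move=> K0 tm Km QL ltQ.
pose bad A := [set O : {set X} | (#|O| == m) && (t <= #|A :&: O|)%N].
have Cpos : (0 < 'C(#|X|, m))%N.
  by rewrite bin_gt0 (leq_trans _ Km) // leq_pmull.
have : (#|\bigcup_(A in Q) bad A| < #|[set O : {set X} | #|O| == m]|)%N.
  rewrite card_draws -(ltn_pmul2l (_ : 0 < K ^ t)%N) ?expn_gt0 ?K0 //.
  apply: (@leq_ltn_trans (#|Q| * 2 ^ L * 'C(#|X|, m))); last first.
    by rewrite ltn_pmul2r.
  apply: (@leq_trans (K ^ t * \sum_(A in Q) #|bad A|)).
    by rewrite leq_mul // card_bigcup_le.
  rewrite big_distrr -mulnA -sum_nat_const /=; apply: leq_sum => A AQ.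
  apply: leq_trans (card_large_intersection A K0 tm Km) _.
  by rewrite leq_mul // leq_exp2l // QL.
move=> lt; have /subsetPn[O] :
    ~~ ([set O : {set X} | #|O| == m] \subset \bigcup_(A in Q) bad A).
  by apply: contraL lt => /subset_leq_card; rewrite -leqNgt.
rewrite inE => /eqP Om nbad; exists O => // A AQ; rewrite ltnNge.
apply: contra nbad => tA; apply/bigcupP; exists A => //.
by rewrite inE Om eqxx.
Qed.

(** * Feasibility of costs defined through the complement *)

Definition complement_cost (R : realType) (X : finType) (c : R)
    (g : {set X} -> R) (S : {set X}) : R :=
  #|~: S|%:R - c * g (~: S).

Lemma marginal_complement_cost (R : realType) (X : finType) (c : R)
    (g : {set X} -> R) (S : {set X}) (j : X) : j \notin S ->
  marginal (complement_cost c g) S j = c * marginal g (~: (j |: S)) j - 1.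
Proof.
move=> jS; rewrite /marginal /complement_cost.
have -> : ~: S = j |: ~: (j |: S).
  by apply/setP => x; rewrite !inE; case: eqP => // ->; rewrite jS.
have -> : #|j |: ~: (j |: S)| = #|~: (j |: S)|.+1.
  by rewrite cardsU1 !inE eqxx.
by rewrite -natr1; ring.
Qed.

Lemma nonincreasing_marginal (R : realType) (X : finType) (f : {set X} -> R) :
  (forall (A : {set X}) j, j \notin A -> marginal f A j <= 0) ->
  nonincreasing_setfun f.
Proof.
move=> df A B; have [k] := ubnP #|B :\: A|.
elim: k B => // k IHk B; rewrite ltnS => ltk AB.
have [/eqP|[j jBA]] := set_0Vmem (B :\: A).
  rewrite setD_eq0 => BA; rewrite (_ : B = A) //.
  by apply/eqP; rewrite eqEsubset BA.
have [jA jB] : j \notin A /\ j \in B by move: jBA; rewrite inE => /andP[].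
have := df (B :\ j) j; rewrite /marginal setD1K // !inE eqxx => /(_ isT).
rewrite subr_le0 => /le_trans; apply; apply: IHk.
  by rewrite setDDl setUC -setDDl (leq_trans _ ltk) // [leqRHS](cardsD1 j) jBA.
by rewrite subsetD1 AB jA.
Qed.

(** All marginals of the cost lie between [-1] and [-(1 - c)], so every ratio in the curvature is at
    least [1 - c]. Complementation reverses inclusions and so turns submodularity of [g] into
    supermodularity. *)
Lemma feasible_complement_cost (R : realType) (X : finType) (c : R)
    (g : {set X} -> R) : 0 < c < 1 -> g set0 = 0 ->
  (forall (A : {set X}) j, j \notin A -> 0 <= marginal g A j <= 1) ->
  (forall (A B : {set X}) j, A \subset B -> j \notin B ->
    marginal g B j <= marginal g A j) ->
  feasible_input c (complement_cost c g).
Proof.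
move=> /andP[c0 c1] g0 g01 gsub.
have df (S : {set X}) j : j \notin S ->
    -1 <= marginal (complement_cost c g) S j <= - (1 - c).
  move=> jS; rewrite marginal_complement_cost //.
  have : 0 <= marginal g (~: (j |: S)) j <= 1 by apply: g01; rewrite !inE eqxx.
  by move: (marginal g _ j) => x; nra.
have mono : nonincreasing_setfun (complement_cost c g).
  by apply: nonincreasing_marginal => A j /df /andP[_]; lra.
split => //.
(* The cost is smallest at [setT], where it is 0. *)
- move=> A; apply: le_trans (mono _ _ (subsetT A)).
  by rewrite /complement_cost setCT g0 cards0; lra.
- move=> A B j AB jB.
  have jA : j \notin A by apply: contra jB; apply: subsetP.
  rewrite !marginal_complement_cost // lerD2r ler_pM2l //; apply: gsub.
    by rewrite setCS setUS.
  by rewrite !inE eqxx.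
- rewrite /curvature lerBlDr addrC -lerBlDr; apply: le_bigmin; first by lra.
  move=> j _; have /andP[lo hi] := df set0 j (negbT (in_set0 j)).
  have /andP[_] := df (setT :\ j) j (negbT (setD11 j setT)).
  rewrite ler_ndivlMr; last by lra.
  by move: (marginal _ _ j) lo hi => x lo hi; nra.
Qed.

(** * The instance hiding a set *)

Section HiddenSet.
Variables (R : realType) (M T tau : nat).
Implicit Types a b s : nat.

Let q : R := 1 - M%:R^-1.

Definition trunc_geom s : R := q ^+ minn s T - q ^+ T.

(* The value of a set with a elements inside the hidden set and b outside.  The
   first tau elements inside count as if they were outside, which hides the set.
   It is M times a coverage probability: the other a - tau elements inside cover
   a fraction (a - tau) / M in total, and each element outside covers a fraction
   1 / M of what is left.  Subtracting q ^+ T from the fraction left by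
   the outside elements makes the value constant once there are T of them. *)
Definition hidden_value a b : R :=
  M%:R * (1 - q ^+ T) - (M%:R - (a - tau)%N%:R) * trunc_geom (b + minn a tau).

Definition hidden_cover (X : finType) (O A : {set X}) : R :=
  hidden_value #|A :&: O| #|A :\: O|.

Hypothesis M0 : (0 < M)%N.
Hypothesis tau0 : (0 < tau)%N.

Let MR : 0 < M%:R :> R. Proof. by rewrite ltr0n. Qed.

Let q0 : 0 <= q.
Proof. by rewrite subr_ge0 invf_le1 // ler1n. Qed.

Let q1 : q <= 1.
Proof. by rewrite lerBlDr lerDl invr_ge0 ltW. Qed.

Let Mq : M%:R * q = M%:R - 1.
Proof. by rewrite mulrBr mulr1 divff // gt_eqF. Qed.

Definition trunc_geom_drop s : R := if (s < T)%N then q ^+ s else 0.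

Lemma trunc_geomS s :
  M%:R * (trunc_geom s - trunc_geom s.+1) = trunc_geom_drop s.
Proof.
rewrite /trunc_geom /trunc_geom_drop; case: (ltnP s T) => sT.
  rewrite (minn_idPl sT) exprS.
  transitivity (M%:R * q ^+ s - M%:R * q * q ^+ s); first by ring.
  by rewrite Mq; ring.
by rewrite (minn_idPr (leqW sT)); ring.
Qed.

Lemma trunc_geom_drop_ge0 s : 0 <= trunc_geom_drop s.
Proof. by rewrite /trunc_geom_drop; case: ifP => // _; rewrite exprn_ge0. Qed.

Lemma trunc_geom_drop_le s s' : (s <= s')%N ->
  trunc_geom_drop s' <= trunc_geom_drop s.
Proof.
move=> ss; rewrite /trunc_geom_drop; case: (ltnP s' T) => s'T.
  by rewrite (leq_ltn_trans ss s'T) ler_wiXn2l.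
exact: trunc_geom_drop_ge0.
Qed.

Lemma trunc_geom_drop_le1 s : trunc_geom_drop s <= 1.
Proof. by rewrite /trunc_geom_drop; case: ifP => // _; rewrite exprn_ile1. Qed.

Lemma trunc_geom_le s s' : (s <= s')%N -> trunc_geom s' <= trunc_geom s.
Proof.
by move=> ss; rewrite lerB // ler_wiXn2l // leq_min geq_minr geq_min ss.
Qed.

Lemma trunc_geom_eq0 s : (T <= s)%N -> trunc_geom s = 0.
Proof. by move=> sT; rewrite /trunc_geom (minn_idPr sT) subrr. Qed.

Lemma trunc_geom_ge0 s : 0 <= trunc_geom s.
Proof. by rewrite subr_ge0 ler_wiXn2l // geq_minr. Qed.

(** This keeps the increments of an inside element decreasing when the inside count reaches [tau],
    where they change from [trunc_geom_drop] to [trunc_geom]. *)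
Lemma trunc_geom_le_drop s : trunc_geom s.+1 <= trunc_geom_drop s.
Proof.
rewrite /trunc_geom_drop; case: ltnP => sT; last first.
  by rewrite trunc_geom_eq0 // leqW.
apply: le_trans (_ : trunc_geom s <= _); first exact: trunc_geom_le.
by rewrite /trunc_geom (minn_idPl (ltnW sT)) lerBlDr lerDl exprn_ge0.
Qed.

Lemma hidden_value_incrr a b :
  hidden_value a b.+1 - hidden_value a b =
  (1 - (a - tau)%N%:R / M%:R) * trunc_geom_drop (b + minn a tau).
Proof.
rewrite -trunc_geomS /hidden_value addSn.
move: (trunc_geom _) (trunc_geom _) => x y.
by field; rewrite gt_eqF.
Qed.

Lemma hidden_value_incrl a b :
  hidden_value a.+1 b - hidden_value a b =
  if (a < tau)%N then trunc_geom_drop (b + a) else trunc_geom (b + tau).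
Proof.
rewrite -trunc_geomS /hidden_value; case: ltnP => ta.
  rewrite (minn_idPl ta) addnS.
  rewrite (eqP (ta : (_ - _)%N == 0%N)) (eqP (ltnW ta : (_ - _)%N == 0%N)).
  by ring.
by rewrite (minn_idPr (leqW ta)) subSn // -natr1; ring.
Qed.

Lemma hidden_value_incrr_le a b a' b' : (a <= a')%N -> (b <= b')%N ->
    (a' <= M + tau)%N ->
  hidden_value a' b'.+1 - hidden_value a' b' <=
  hidden_value a b.+1 - hidden_value a b.
Proof.
move=> aa bb aM; rewrite !hidden_value_incrr.
apply: ler_pM.
- by rewrite subr_ge0 ler_pdivrMr // mul1r ler_nat leq_subLR addnC.
- exact: trunc_geom_drop_ge0.
- by rewrite lerB // ler_pM2r ?invr_gt0 // ler_nat leq_sub2r.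
- by rewrite trunc_geom_drop_le // leq_add // leq_min geq_minr geq_min aa.
Qed.

Lemma hidden_value_incrl_le a b a' b' : (a <= a')%N -> (b <= b')%N ->
  hidden_value a'.+1 b' - hidden_value a' b' <=
  hidden_value a.+1 b - hidden_value a b.
Proof.
move=> aa bb; rewrite !hidden_value_incrl.
case: (ltnP a' tau) => ta'.
  by rewrite (leq_ltn_trans aa ta') trunc_geom_drop_le // leq_add.
case: (ltnP a tau) => ta; last by rewrite trunc_geom_le // leq_add2r.
(* Mixed case [a < tau <= a'], in which [(b + a).+1 <= b' + tau]. *)
apply: le_trans (trunc_geom_le_drop _).
by rewrite trunc_geom_le // -addnS leq_add.
Qed.

Lemma hidden_value00 : hidden_value 0 0 = 0.
Proof.
by rewrite /hidden_value /trunc_geom min0n addn0 min0n sub0n expr0; ring.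
Qed.

Lemma hidden_value_incrr_bound a b : (a <= M + tau)%N ->
  0 <= hidden_value a b.+1 - hidden_value a b <= 1.
Proof.
move=> aM; apply/andP; split.
  rewrite hidden_value_incrr mulr_ge0 ?trunc_geom_drop_ge0 //.
  by rewrite subr_ge0 ler_pdivrMr // mul1r ler_nat leq_subLR addnC.
apply: le_trans (hidden_value_incrr_le (leq0n a) (leq0n b) aM) _.
by rewrite hidden_value_incrr sub0n mul0r subr0 mul1r trunc_geom_drop_le1.
Qed.

Lemma hidden_value_incrl_bound a b :
  0 <= hidden_value a.+1 b - hidden_value a b <= 1.
Proof.
apply/andP; split.
  rewrite hidden_value_incrl.
  by case: ifP; rewrite ?trunc_geom_drop_ge0 ?trunc_geom_ge0.
apply: le_trans (hidden_value_incrl_le (leq0n a) (leq0n b)) _.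
by rewrite hidden_value_incrl tau0 trunc_geom_drop_le1.
Qed.

Lemma marginal_hidden_cover (X : finType) (O A : {set X}) (j : X) :
  j \notin A ->
  marginal (hidden_cover O) A j =
  if j \in O then hidden_value #|A :&: O|.+1 #|A :\: O| - hidden_cover O A
  else hidden_value #|A :&: O| #|A :\: O|.+1 - hidden_cover O A.
Proof.
move=> jA; rewrite /marginal {1}/hidden_cover; case: ifP => jO.
  have -> : (j |: A) :&: O = j |: (A :&: O).
    by rewrite setIUl (setIidPl _) // sub1set.
  have -> : (j |: A) :\: O = A :\: O.
    by apply/setP => x; rewrite !inE; case: eqP => // ->; rewrite jO.
  by rewrite cardsU1 inE (negPf jA).
have -> : (j |: A) :&: O = A :&: O.
  by apply/setP => x; rewrite !inE; case: eqP => // ->; rewrite jO (negPf jA).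
have -> : (j |: A) :\: O = j |: (A :\: O).
  by apply/setP => x; rewrite !inE; case: eqP => // ->; rewrite jO.
by rewrite cardsU1 inE (negPf jA) andbF.
Qed.

Lemma feasible_hidden_cover (X : finType) (O : {set X}) (c : R) :
  0 < c < 1 -> (#|O| <= M + tau)%N ->
  feasible_input c (complement_cost c (hidden_cover O)).
Proof.
move=> c01 OM.
have aM A : (#|A :&: O| <= M + tau)%N.
  by rewrite (leq_trans _ OM) // subset_leq_card // subsetIr.
apply: feasible_complement_cost => //.
- by rewrite /hidden_cover set0I set0D cards0 hidden_value00.
- move=> A j jA; rewrite marginal_hidden_cover // /hidden_cover.
  case: ifP => _; first exact: hidden_value_incrl_bound.
  exact: hidden_value_incrr_bound.
- move=> A B j AB jB.
  have jA : j \notin A by apply: contra jB; apply: subsetP.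
  have [leI leD] : (#|A :&: O| <= #|B :&: O|)%N /\ (#|A :\: O| <= #|B :\: O|)%N.
    by rewrite !subset_leq_card ?setSI ?setSD.
  rewrite !marginal_hidden_cover // /hidden_cover.
  case: ifP => _; first exact: hidden_value_incrl_le.
  exact: hidden_value_incrr_le.
Qed.

Lemma hidden_value_sym a b : (a <= tau)%N ->
  hidden_value a b = hidden_value 0 (a + b).
Proof.
move=> ta; rewrite /hidden_value min0n addn0 (minn_idPl ta) addnC.
by rewrite (eqP (ta : (_ - _)%N == 0%N)).
Qed.

Lemma hidden_value_sat a b : (T <= b)%N ->
  hidden_value a b = M%:R * (1 - q ^+ T).
Proof.
move=> Tb; rewrite /hidden_value trunc_geom_eq0 ?mulr0 ?subr0 //.
exact: leq_trans Tb (leq_addr _ _).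
Qed.

(** In the first case every element of [A] counts as an outside one; in the second at least [T]
    elements of [A] lie outside [O], so both values are saturated. *)
Lemma hidden_cover_sym (X : finType) (O A : {set X}) :
  (#|A :&: O| <= tau)%N \/ (T + #|O| <= #|A|)%N ->
  hidden_cover O A = hidden_cover set0 A.
Proof.
have cA : (#|A :&: O| + #|A :\: O|)%N = #|A| by rewrite cardsID.
rewrite /hidden_cover setI0 setD0 cards0 => -[ta|TA].
  by rewrite hidden_value_sym ?cA.
have IO : (#|A :&: O| <= #|O|)%N by rewrite subset_leq_card // subsetIr.
by rewrite !hidden_value_sat //; lia.
Qed.

Lemma hidden_cover_self (X : finType) (O : {set X}) :
  #|O| = (M + tau)%N -> hidden_cover O O = M%:R * (1 - q ^+ T).
Proof.
move=> OM; rewrite /hidden_cover /hidden_value setIid OM addnK.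
by rewrite subrr mul0r subr0.
Qed.

Lemma hidden_value0_le s : hidden_value 0 s <= M%:R * (1 - q ^+ s).
Proof.
rewrite /hidden_value /trunc_geom min0n addn0 sub0n subr0 -mulrBr ler_pM2l //.
by rewrite opprB addrA subrK lerB // ler_wiXn2l // geq_minl.
Qed.

(** With nothing hidden the cost depends on [#|~: S|] only, and it grows with it because the
    increments of the cover are at most 1 and [c < 1]. So the case of size [m] decides. *)
Lemma symmetric_cost_ge (X : finType) (c : R) (m : nat) (S : {set X}) :
  0 < c < 1 -> (m <= #|~: S|)%N ->
  m%:R - c * (M%:R * (1 - q ^+ m)) <= complement_cost c (hidden_cover set0) S.
Proof.
move=> /andP[c0 c1]; rewrite /complement_cost /hidden_cover setI0 setD0 cards0.
elim: #|_| => [|s IHs].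
  by rewrite leqn0 => /eqP ->; rewrite expr0 subrr hidden_value00 !mulr0.
rewrite leq_eqVlt => /orP[/eqP <-|].
  by rewrite lerB // ler_pM2l // hidden_value0_le.
rewrite ltnS => /IHs /le_trans; apply.
have := hidden_value_incrr_bound s (leq0n _ : (0 <= M + tau)%N).
rewrite -natr1; move: (hidden_value 0 s.+1) (hidden_value 0 s) => x y; nra.
Qed.

End HiddenSet.

(** * Numerical estimates for the limiting ratio *)

(** From [M / (M - 1) <= expR (1 / (M - 1))], the power is at least [expR (- 1 - x)], hence at least
    [expR (- 1) * (1 - x)]. *)
Lemma expr_1Binv_ge (R : realType) (M m : nat) (x : R) :
  (1 < M)%N -> 0 <= x -> m%:R <= (1 + x) * (M%:R - 1) ->
  expR (- 1) - x <= (1 - M%:R^-1) ^+ m.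
Proof.
move=> M1 x0 mx; have MR : 1 < M%:R :> R by rewrite ltr1n.
have le_q : expR (- (M%:R - 1)^-1) <= 1 - M%:R^-1 :> R.
  rewrite expRN -[leRHS]invrK lef_pV2 ?posrE ?expR_gt0 //.
    apply: le_trans (expR_ge1Dx _).
    rewrite le_eqVlt; apply/orP; left; apply/eqP; field.
    by rewrite subr_eq0 !gt_eqF //; lra.
  by rewrite invr_gt0 subr_gt0 invf_lt1 //; lra.
apply: (@le_trans _ _ (expR (- (M%:R - 1)^-1) ^+ m)); last first.
  by rewrite lerXn2r // ?nnegrE ?expR_ge0 // (le_trans _ le_q) // expR_ge0.
rewrite -expRM_natl.
apply: (@le_trans _ _ (expR (- 1 + - x))); last first.
  rewrite ler_expR mulrN -opprD lerN2 ler_pdivrMr //; lra.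
rewrite expRD.
have := expR_ge1Dx (- x); have : expR (- 1) <= 1 :> R by rewrite expR_le1; lra.
have := expR_gt0 (- 1 : R); move: (expR _) (expR _) => y z; nra.
Qed.

Lemma expr_1Binv_le (R : realType) (M N : nat) : (0 < M)%N -> (0 < N)%N ->
  (1 - M%:R^-1) ^+ (N * M) <= N%:R^-1 :> R.
Proof.
move=> M0 N0; have MR : 0 < M%:R :> R by rewrite ltr0n.
apply: (@le_trans _ _ (expR (- M%:R^-1) ^+ (N * M))).
  rewrite lerXn2r ?nnegrE ?expR_ge0 ?expR_ge1Dx //.
  by rewrite subr_ge0 invf_le1 // ler1n.
rewrite -expRM_natl natrM mulrN mulfK ?gt_eqF // expRN.
rewrite lef_pV2 ?posrE ?expR_gt0 ?ltr0n //.
by apply: le_trans (expR_ge1Dx _); lra.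
Qed.

(** Here [u] and [v] stand for the powers [m] and [T] of [1 - 1 / M]. Per unit of [m], the optimum
    is at most [1 - c + c * eps] and the algorithm pays at least [1 - c + c * e - c * eps]. After
    multiplication by [1 - c] the errors total at most [2 * eps], against a slack of
    [delta * (1 - c) ^+ 2]. *)
Lemma ratio_gap (R : realType) (c delta e eps m M u v : R) :
  0 < c < 1 -> 0 < delta -> 0 < e <= 1 -> 0 < m -> M <= m ->
  m * (1 - eps / 2) <= M -> 0 <= eps ->
  e - eps <= u <= 1 -> 0 <= v <= eps / 2 ->
  2 * eps < delta * (1 - c) ^+ 2 -> 0 <= 1 + c / (1 - c) * e - delta ->
  (1 + c / (1 - c) * e - delta) * (m - c * (M * (1 - v))) <
    m - c * (M * (1 - u)).
Proof.
move=> /andP[c0 c1] d0 /andP[e0 e1] m0 Mm mM eps0.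
move=> /andP[ue u1] /andP[v0 veps] epsd.
set alpha := (1 + _ - _) => alpha0.
have alphac : alpha * (1 - c) = 1 - c + c * e - delta * (1 - c).
  by rewrite /alpha; field; lra.
have alphac1 : alpha * (1 - c) <= 1 by rewrite alphac; nra.
have X : m * (1 - c + c * e - c * eps) <= m - c * (M * (1 - u)).
  have : M * (1 - u) <= m * (1 - e + eps).
    apply: (@le_trans _ _ (m * (1 - u))).
      by rewrite ler_wpM2r //; lra.
    by rewrite ler_wpM2l //; lra.
  nra.
(* Nonnegativity of [alpha] bounds [delta * (1 - c)] by 1, hence [eps]; this makes [1 - eps / 2]
   nonnegative for the product below. *)
have eps2 : eps <= 2 by nra.
have Y : m - c * (M * (1 - v)) <= m * (1 - c + c * eps).
  have : m * (1 - eps) <= M * (1 - v).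
    apply: (@le_trans _ _ (m * (1 - eps / 2) * (1 - eps / 2))); first by nra.
    by apply: ler_pM; nra.
  nra.
apply: le_lt_trans (ler_wpM2l alpha0 Y) (lt_le_trans _ X).
rewrite mulrCA ltr_pM2l // mulrDr alphac.
rewrite -(ltr_pM2r (_ : 0 < 1 - c)); last by lra.
have : alpha * (1 - c) * (c * eps) <= c * eps.
  by rewrite ler_piMl // mulr_ge0 // ltW.
have : 0 <= c ^+ 2 * eps by rewrite mulr_ge0 // sqr_ge0.
have : 0 <= (1 - c) * eps by rewrite mulr_ge0 //; lra.
move: alpha alpha0 alphac alphac1 Y X => alpha *; lra.
Qed.

(** * The optimum, and fooling a given algorithm *)

Lemma opt_ge0 (R : realType) (X : finType) (f : {set X} -> R) (r : nat) :
  (forall A, 0 <= f A) -> 0 <= opt f r.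
Proof. by move=> f0; apply: le_bigmin. Qed.

Lemma opt_le (R : realType) (X : finType) (f : {set X} -> R) (r : nat)
    (A : {set X}) :
  (#|A| <= r)%N -> opt f r <= f A.
Proof. by move=> Ar; apply: bigmin_le_cond. Qed.

Theorem theorem10 (R : realType) (delta c : R) :
  0 < delta -> 0 < c < 1 ->
  ~ exists alg : algorithm R,
      polynomial_evaluations c alg /\
      achieves_ratio c (1 + c / (1 - c) * expR (- 1) - delta) alg.
Proof.
move=> d0 c01 [alg [[p poly_alg] ratio_alg]].
have [c0 c1] := andP c01.
have dc0 : 0 < delta * (1 - c) ^+ 2.
  by rewrite mulr_gt0 // exprn_gt0 // subr_gt0.
(* [N] sets the precision: the error will be [eps = 2 / (N - 2)], and this is the condition
   [2 * eps < delta * (1 - c) ^+ 2]. *)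
have [N N3 ltN] : exists2 N : nat, (2 < N)%N &
    4 < delta * (1 - c) ^+ 2 * (N%:R - 2).
  set B := 4 / (delta * (1 - c) ^+ 2).
  have B0 : 0 <= B by rewrite divr_ge0 // ltW.
  exists (Num.Def.archi_bound B + 3)%N; first by rewrite addn3.
  rewrite mulrC -ltr_pdivrMr // natrD.
  by have := archi_boundP B0; rewrite -/B; lra.
(* Then [K ^ t = 2 ^ L * 2 ^ t] for [L = N * N * t]: the factor [2 ^ L] pays for the subsets of a
   set of size [L], and [2 ^ t] exceeds the number of sets to fool. As [K] and [N] do not depend on
   [t], the size [n] is linear in [t]. *)
pose K := (2 ^ (N * N + 1))%N.
have KN0 : (0 < K * N)%N by rewrite muln_gt0 expn_gt0; lia.
have [t t0 lt_pt] := poly_lt_exp2 p KN0.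
(* The threshold [tau] is [t], a fraction [1 / N] of the hidden set; the other [M] elements suffice
   to reach full cover. *)
pose n := (K * N * t)%N; pose m := (N * t)%N; pose M := (N.-1 * t)%N.
pose T := (N * M)%N; pose L := (N * N * t)%N.
have M1 : (1 < M)%N by rewrite /M; nia.
have Mt : (M + t)%N = m by rewrite /M /m; nia.
have M0 : (0 < M)%N by exact: ltnW.
have N0 : (0 < N)%N by exact: leq_trans N3.
have Mm : (M <= m)%N by rewrite -Mt leq_addr.
have TL : (T + m)%N = L by rewrite /T /L /M /m; nia.
pose f (O : {set 'I_n}) := complement_cost c (@hidden_cover R M T t _ O).
have feas (O : {set 'I_n}) : (#|O| <= m)%N -> feasible_input c (f O).
  by rewrite -Mt; apply: feasible_hidden_cover => //; lia.
pose a := alg n (n - m)%N; pose S := output (f set0) a.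
have feas0 : feasible_input c (f set0) by apply: feas; rewrite cards0.
pose Q := S |: evaluated (f set0) a.
(* Complements larger than [L = T + m] saturate the cover whatever [O] is, so only the others have
   to meet [O] in few elements. *)
pose QL := [set A in [set ~: B | B in Q] | (#|A| <= L)%N].
have [O Om QO] : exists2 O : {set 'I_n}, #|O| = m &
    forall A, A \in QL -> (#|A :&: O| < t)%N.
  apply: (@exists_small_intersection _ _ K t m L).
  - by rewrite expn_gt0.
  - by rewrite -Mt leq_addl.
  - by rewrite card_ord /m mulnA.
  - by move=> A; rewrite inE => /andP[].
  - rewrite /K -expnM mulnDl mul1n expnD mulnC ltn_pmul2l ?expn_gt0 //.
    apply: leq_ltn_trans lt_pt; rewrite addnC.
    apply: (@leq_trans #|[set ~: B | B in Q]|).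
      by rewrite subset_leq_card //; apply/subsetP => A; rewrite inE => /andP[].
    rewrite (leq_trans (leq_imset_card _ _)) // cardsU1 leq_add ?leq_b1 //.
    exact: poly_alg.
have eqQ (B : {set 'I_n}) : B \in Q -> f O B = f set0 B.
  move=> BQ; rewrite /f /complement_cost hidden_cover_sym //.
  have [BL|/ltnW LB] := leqP #|~: B| L; last by right; rewrite Om TL.
  by left; apply/ltnW/QO; rewrite inE BL andbT imset_f.
have outS : output (f O) a = S.
  by apply: output_eq => B aB; apply: eqQ; rewrite inE aB orbT.
have feasO : feasible_input c (f O) by apply: feas; rewrite Om.
have [leS] := ratio_alg n (n - m)%N (f O) feasO.
rewrite -/a outS eqQ ?setU11 // in leS *.
have m_le : (m <= #|~: S|)%N.
  have mn : (m <= n)%N by rewrite /m /n -mulnA leq_pmull // expn_gt0.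
  have := cardsC S; rewrite card_ord; lia.
have : m%:R - c * (M%:R * (1 - (1 - M%:R^-1) ^+ m)) <= f set0 S.
  by apply: symmetric_cost_ge => //; lia.
(* The witness is [~: O], whose complement [O] reaches full cover. *)
have optO : opt (f O) (n - m) <= m%:R - c * (M%:R * (1 - (1 - M%:R^-1) ^+ T)).
  apply: le_trans (opt_le _ (_ : #|~: O| <= _)%N) _.
    by have := cardsC O; rewrite card_ord Om; lia.
  by rewrite /f /complement_cost setCK Om hidden_cover_self ?Om.
have opt0 : 0 <= opt (f O) (n - m) by apply: opt_ge0; case: feasO.
move=> le1 le2; have := le_trans le1 le2; apply/negP; rewrite -ltNge {le1 le2}.
have NR : 2 < N%:R :> R by rewrite ltr_nat.
have tR : 1 <= t%:R :> R by rewrite ler1n.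
have MR : M%:R = (N%:R - 1) * t%:R :> R.
  by rewrite /M natrM -subn1 natrB.
have mR : m%:R = N%:R * t%:R :> R by rewrite /m natrM.
have q01 : 0 <= 1 - (M%:R : R)^-1 <= 1.
  by rewrite lerBlDr lerDl invr_ge0 ler0n subr_ge0 invf_le1 ?ler1n ?ltr0n ?M0.
have [q0 q1] := andP q01.
(* For large [delta] the ratio may be negative; then the bound on the output is at most 0, while its
   cost is at least [m - M = t > 0]. *)
have [alpha0|alpha0] := leP 0 (1 + c / (1 - c) * expR (- 1) - delta);
  last first.
  apply: (@le_lt_trans _ _ 0); first by rewrite nmulr_rle0.
  have : 0 <= (1 - M%:R^-1) ^+ m :> R by rewrite exprn_ge0.
  rewrite mR MR; move: (_ ^+ m) => u u0.
  have Nt0 : 0 <= (N%:R - 1) * t%:R :> R by rewrite mulr_ge0 //; lra.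
  have : c * ((N%:R - 1) * t%:R * (1 - u)) <= (N%:R - 1) * t%:R.
    apply: (@le_trans _ _ (c * ((N%:R - 1) * t%:R))).
      by rewrite ler_pM2l // ler_piMr //; lra.
    by rewrite ler_piMl // ltW.
  lra.
apply: le_lt_trans (ler_wpM2l alpha0 optO) _.
have N20 : 0 < (N%:R - 2)^-1 :> R by rewrite invr_gt0 subr_gt0.
have invN : N%:R^-1 <= (N%:R - 2)^-1 :> R.
  by rewrite lef_pV2 ?posrE ?subr_gt0 ?ltr0n // lerBlDr lerDl.
have N2V : (N%:R - 2) * (N%:R - 2)^-1 = 1 :> R.
  by rewrite divff // gt_eqF // subr_gt0.
(* Since [M - 1 >= (N - 2) * t], the quotient [m / (M - 1)] is at most [N / (N - 2) = 1 + eps]. Half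
   of [eps] also covers [1 / N], which is [1 - M / m] and a bound on [v]. *)
apply: (@ratio_gap _ _ _ _ (2 * (N%:R - 2)^-1)) => //.
- by rewrite expR_gt0 expR_le1; lra.
- by rewrite ltr0n (leq_trans M0 Mm).
- by rewrite ler_nat.
- rewrite mR MR -mulrA [leRHS]mulrC mulrCA ler_pM2l; last by lra.
  by move: N2V; move: (N%:R : R) ((N%:R - 2)^-1 : R) N20 => x y; lra.
- by rewrite mulr_ge0 // ltW.
- rewrite exprn_ile1 // andbT; apply: expr_1Binv_ge => //.
    by rewrite mulr_ge0 // ltW.
  rewrite mR MR.
  have -> : (1 + 2 * (N%:R - 2)^-1) * ((N%:R - 1) * t%:R - 1) =
    N%:R * ((N%:R - 1) * t%:R - 1) * (N%:R - 2)^-1 :> R.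
    by field; rewrite gt_eqF // subr_gt0.
  rewrite ler_pdivlMr ?subr_gt0 // -mulrA ler_pM2l ?ltr0n //.
  by move: (N%:R : R) (t%:R : R) tR => x y; lra.
- rewrite exprn_ge0 //=; apply: le_trans (expr_1Binv_le _ M0 N0) _.
  by rewrite mulrAC divff ?mul1r // pnatr_eq0.
- by rewrite mulrA -natrM ltr_pdivrMr ?subr_gt0 //.
Qed.
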